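(* (1) $\mathrm{FOT}(\to)$ has the empty team property: for every model $M$ and every $\mathrm{FOT}(\to)$-formula $\varphi$, $M,\emptyset\models\varphi$. (2) $\mathrm{FOT}(\to)$ is local: for every model $M$, every team $X$ over $M$ (with domain containing $\mathrm{fv}(\varphi)$), and every $\mathrm{FOT}(\to)$-formula $\varphi$, $M,X\models\varphi$ iff $M,X\mathop{\upharpoonright}\mathrm{fv}(\varphi)\models\varphi$. (3) For every model $M$, every $\mathrm{FOT}(\to)$-formula $\varphi$ and every assignment $s$ (with domain containing $\mathrm{fv}(\varphi)$), $M,s\models_{\mathrm{FOL}}\varphi^\sharp$ iff $M,\{s\}\models\varphi$. (4) For every $\mathrm{FOT}(\to)$-sentence $\sigma$ and every model $M$, $M\models_{\mathrm{FOL}}\sigma^\sharp$ iff $M\models\sigma$. (5) For every $\mathrm{FOT}(\to)$-formula $\varphi$ there exists a sentence $\varphi^*$ of second-order logic such that for all $M$ and all teams $X$ over $\mathrm{fv}(\varphi)=\bar x$, $$M,X\models\varphi\quad\Longleftrightarrow\quad (M,\mathrm{rel}(X))\models\varphi^*,$$ where $\mathrm{rel}(X)=\{s(\bar x): s\in X\}$.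
   Context: Structures $M$ have nonempty domain; the same letter denotes a structure and its domain. An assignment over $M$ is a map from a finite set of variables to $M$. A team over $M$ is a set of assignments with a common domain; the empty team is allowed. $s(a/x)$ is the assignment mapping $x$ to $a$ and otherwise agreeing with $s$; $X(a/x)=\{s(a/x):s\in X\}$; $X\mathop{\upharpoonright}V=\{s\mathop{\upharpoonright}V:s\in X\}$. $\mathrm{fv}(\varphi)$ is the set of free variables of $\varphi$; a sentence is a formula with no free variables, and for a sentence $\sigma$, $M\models\sigma$ means $M,\{\emptyset\}\models\sigma$, where $\emptyset$ here is the assignment with empty domain. Formulas of $\mathrm{FOT}(\to)$: $\varphi::=\lambda\mid\bar x\neq\bar y\mid\dot\sim\varphi\mid(\varphi\land\varphi)\mid(\varphi\vee_w\varphi)\mid\exists^1x\,\varphi\mid\forall^1x\,\varphi\mid(\varphi\to\varphi)$, where $\lambda$ is a first-order atomic formula (including equality) and $\bar x,\bar y$ are tuples of variables of equal length. Satisfaction $M,X\models\varphi$ (the domain of $X$ contains the free variables of $\varphi$): - $M,X\models\lambda$ iff every $s\in X$ satisfies $\lambda$ in $M$ in the usual first-order sense; - $M,X\models\bar x\neq\bar y$ iff $s(\bar x)\neq s(\bar y)$ for all $s\in X$; - $M,X\models\dot\sim\varphi$ iff $X=\emptyset$ or $M,X\not\models\varphi$; - $M,X\models\varphi\land\psi$ iff $M,X\models\varphi$ and $M,X\models\psi$; - $M,X\models\varphi\vee_w\psi$ iff $M,X\models\varphi$ or $M,X\models\psi$; - $M,X\models\exists^1x\,\varphi$ iff $M,X(a/x)\models\varphi$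 for some $a\in M$; - $M,X\models\forall^1x\,\varphi$ iff $M,X(a/x)\models\varphi$ for all $a\in M$; - $M,X\models\varphi\to\psi$ iff for every $Y\subseteq X$, if $M,Y\models\varphi$ then $M,Y\models\psi$. $\varphi^\sharp$ is the first-order formula obtained from $\varphi$ by replacing $\dot\sim,\vee_w,\exists^1,\forall^1$ by $\neg,\vee,\exists,\forall$ respectively, keeping $\land$, with $(\bar x\neq\bar y)^\sharp:=\neg\bigwedge_i x_i=y_i$ and $(\varphi\to\psi)^\sharp:=\varphi^\sharp\to\psi^\sharp$ (classical implication). $\models_{\mathrm{FOL}}$ is ordinary Tarskian satisfaction. In (5), $\varphi^*$ is in the signature of $\varphi$ expanded by a fresh $|\bar x|$-ary relation symbol $R$ (where $\bar x$ enumerates $\mathrm{fv}(\varphi)$), $(M,\mathrm{rel}(X))$ is the expansion of $M$ interpreting $R$ by $\mathrm{rel}(X)$, and second-order logic has full semantics. *)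

(* Defs.v *)
From mathcomp Require Import all_boot.
From mathcomp Require Import finmap.
From mathcomp Require Import classical_sets.

Set Implicit Arguments.
Unset Strict Implicit.
Unset Printing Implicit Defensive.

Local Open Scope fset_scope.
Local Open Scope fmap_scope.
Local Open Scope classical_set_scope.

Record signature := Signature {
  funsym : Type;
  fun_arity : funsym -> nat;
  relsym : Type;
  rel_arity : relsym -> nat }.

Record structure (sg : signature) := Structure {
  carrier :> Type;
  carrier_nonempty : inhabited carrier;
  fun_interp : forall f : funsym sg, (fun_arity f).-tuple carrier -> carrier;
  rel_interp : forall R : relsym sg, set ((rel_arity R).-tuple carrier) }.

Definition var := nat.

Definition assignment (T : Type) := {fmap var -> T}.

(* Teams over M are the sets of assignments satisfying [is_team D] for some
   common domain D; the empty set is a team with every domain. *)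
Definition is_team (T : Type) (D : {fset var}) (X : set (assignment T)) :=
  forall s, X s -> domf s = D.

Definition team_subst (T : Type) (X : set (assignment T)) (a : T) (x : var)
  : set (assignment T) := (fun s : assignment T => s.[x <- a]) @` X.

Definition team_restrict (T : Type) (X : set (assignment T)) (V : {fset var})
  : set (assignment T) := (fun s : assignment T => s.[& V]) @` X.

(* [tuple_value s x v]: s is defined on the variables x, and s(x) = v. *)
Definition tuple_value (T : Type) (s : assignment T) (n : nat)
    (x : n.-tuple var) (v : n.-tuple T) :=
  forall i : 'I_n, s.[? tnth x i] = Some (tnth v i).

Definition team_rel (T : Type) (n : nat) (x : n.-tuple var)
    (X : set (assignment T)) : set (n.-tuple T) :=
  [set v | exists2 s, X s & tuple_value s x v].

(* Arguments are functions on ordinals rather than tuples, for the sake of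
   strict positivity. *)
Inductive term (sg : signature) : Type :=
| Var of var
| App (f : funsym sg) of ('I_(fun_arity f) -> term sg).
Arguments Var {sg}.

Fixpoint term_fv (sg : signature) (t : term sg) : {fset var} :=
  match t with
  | Var x => [fset x]
  | App f ts => \bigcup_(i <- enum 'I_(fun_arity f)) term_fv (ts i)
  end%fset.

(* [term_value s t a]: the term t is defined under s, with value a.  Evaluation
   is a relation because assignments are partial. *)
Fixpoint term_value (sg : signature) (M : structure sg) (s : assignment M)
    (t : term sg) (a : M) : Prop :=
  match t with
  | Var x => s.[? x] = Some a
  | App f ts =>
      exists2 v : (fun_arity f).-tuple M,
        forall i, term_value s (ts i) (tnth v i) & fun_interp v = a
  end.

Inductive atom (sg : signature) : Type :=
| Eq of term sg & term sg
| Rel (R : relsym sg) of ('I_(rel_arity R) -> term sg).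

Definition atom_fv (sg : signature) (l : atom sg) : {fset var} :=
  match l with
  | Eq t u => term_fv t `|` term_fv u
  | Rel R ts => \bigcup_(i <- enum 'I_(rel_arity R)) term_fv (ts i)
  end%fset.

Definition atom_sat (sg : signature) (M : structure sg) (s : assignment M)
    (l : atom sg) : Prop :=
  match l with
  | Eq t u => exists2 a : M, term_value s t a & term_value s u a
  | Rel R ts =>
      exists2 v : (rel_arity R).-tuple M,
        forall i, term_value s (ts i) (tnth v i) & rel_interp v
  end.

Inductive fot (sg : signature) : Type :=
| FOTatom of atom sg
| FOTneq (n : nat) of n.-tuple var & n.-tuple var
| FOTneg of fot sg
| FOTand of fot sg & fot sg
| FOTor of fot sg & fot sg
| FOTex1 of var & fot sg
| FOTall1 of var & fot sg
| FOTimp of fot sg & fot sg.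
Arguments FOTneq {sg n}.

Fixpoint fv (sg : signature) (phi : fot sg) : {fset var} :=
  match phi with
  | FOTatom l => atom_fv l
  | FOTneq n x y => [fset z in tval x] `|` [fset z in tval y]
  | FOTneg p => fv p
  | FOTand p q | FOTor p q | FOTimp p q => fv p `|` fv q
  | FOTex1 x p | FOTall1 x p => fv p `\ x
  end%fset.

Fixpoint sat (sg : signature) (M : structure sg) (X : set (assignment M))
    (phi : fot sg) : Prop :=
  match phi with
  | FOTatom l => forall s, X s -> atom_sat s l
  | FOTneq n x y => forall s, X s ->
      exists v w : n.-tuple M,
        [/\ tuple_value s x v, tuple_value s y w & v <> w]
  | FOTneg p => X = set0 \/ ~ sat X p
  | FOTand p q => sat X p /\ sat X q
  | FOTor p q => sat X p \/ sat X q
  | FOTex1 x p => exists a : M, sat (team_subst X a x) p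
  | FOTall1 x p => forall a : M, sat (team_subst X a x) p
  | FOTimp p q => forall Y, Y `<=` X -> sat Y p -> sat Y q
  end.

Definition fot_sentence (sg : signature) (phi : fot sg) := fv phi = fset0.

Definition fot_true (sg : signature) (M : structure sg) (phi : fot sg) :=
  sat [set [fmap] : assignment M] phi.

Inductive fo (sg : signature) : Type :=
| FOatom of atom sg
| FOneg of fo sg
| FOand of fo sg & fo sg
| FOor of fo sg & fo sg
| FOimp of fo sg & fo sg
| FOex of var & fo sg
| FOall of var & fo sg.

Fixpoint fo_sat (sg : signature) (M : structure sg) (s : assignment M)
    (phi : fo sg) : Prop :=
  match phi with
  | FOatom l => atom_sat s l
  | FOneg p => ~ fo_sat s p
  | FOand p q => fo_sat s p /\ fo_sat s q
  | FOor p q => fo_sat s p \/ fo_sat s q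
  | FOimp p q => fo_sat s p -> fo_sat s q
  | FOex x p => exists a : M, fo_sat s.[x <- a] p
  | FOall x p => forall a : M, fo_sat s.[x <- a] p
  end.

Definition fo_true (sg : signature) (M : structure sg) (phi : fo sg) :=
  fo_sat ([fmap] : assignment M) phi.

Definition fo_top (sg : signature) : fo sg :=
  FOall 0 (FOatom (Eq (Var 0) (Var 0))).

Fixpoint fo_bigand (sg : signature) (ps : seq (fo sg)) : fo sg :=
  match ps with
  | [::] => fo_top sg
  | [:: p] => p
  | p :: qs => FOand p (fo_bigand qs)
  end.

Fixpoint sharp (sg : signature) (phi : fot sg) : fo sg :=
  match phi with
  | FOTatom l => FOatom l
  | FOTneq n x y =>
      FOneg (fo_bigand [seq FOatom (Eq (Var (tnth x i)) (Var (tnth y i)))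
                        | i <- enum 'I_n])
  | FOTneg p => FOneg (sharp p)
  | FOTand p q => FOand (sharp p) (sharp q)
  | FOTor p q => FOor (sharp p) (sharp q)
  | FOTex1 x p => FOex x (sharp p)
  | FOTall1 x p => FOall x (sharp p)
  | FOTimp p q => FOimp (sharp p) (sharp q)
  end.

(* A relation variable is an (arity, name) pair. *)
Definition relvar := (nat * nat)%type.
Definition relvar_arity (Z : relvar) : nat := Z.1.

Inductive so (sg : signature) : Type :=
| SOatom of atom sg
| SOvar (Z : relvar) of ('I_(relvar_arity Z) -> term sg)
| SOneg of so sg
| SOand of so sg & so sg
| SOor of so sg & so sg
| SOimp of so sg & so sg
| SOex of var & so sg
| SOall of var & so sg
| SOexR of relvar & so sg
| SOallR of relvar & so sg.

Fixpoint so_fv (sg : signature) (phi : so sg) : {fset var} :=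
  match phi with
  | SOatom l => atom_fv l
  | SOvar Z ts => \bigcup_(i <- enum 'I_(relvar_arity Z)) term_fv (ts i)
  | SOneg p => so_fv p
  | SOand p q | SOor p q | SOimp p q => so_fv p `|` so_fv q
  | SOex x p | SOall x p => so_fv p `\ x
  | SOexR _ p | SOallR _ p => so_fv p
  end%fset.

Fixpoint so_frv (sg : signature) (phi : so sg) : {fset relvar} :=
  match phi with
  | SOatom _ => fset0
  | SOvar Z _ => [fset Z]
  | SOneg p => so_frv p
  | SOand p q | SOor p q | SOimp p q => so_frv p `|` so_frv q
  | SOex _ p | SOall _ p => so_frv p
  | SOexR Z p | SOallR Z p => so_frv p `\ Z
  end%fset.

Definition so_sentence (sg : signature) (phi : so sg) :=
  so_fv phi = fset0 /\ so_frv phi = fset0.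

Definition rel_assignment (T : Type) :=
  forall Z : relvar, set ((relvar_arity Z).-tuple T).

Fixpoint so_sat (sg : signature) (M : structure sg) (E : rel_assignment M)
    (s : assignment M) (phi : so sg) : Prop :=
  match phi with
  | SOatom l => atom_sat s l
  | SOvar Z ts =>
      exists2 v : (relvar_arity Z).-tuple M,
        forall i, term_value s (ts i) (tnth v i) & E Z v
  | SOneg p => ~ so_sat E s p
  | SOand p q => so_sat E s p /\ so_sat E s q
  | SOor p q => so_sat E s p \/ so_sat E s q
  | SOimp p q => so_sat E s p -> so_sat E s q
  | SOex x p => exists a : M, so_sat E s.[x <- a] p
  | SOall x p => forall a : M, so_sat E s.[x <- a] p
  | SOexR Z p =>
      exists P : set ((relvar_arity Z).-tuple M), so_sat (dfwith E P) s p
  | SOallR Z p =>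
      forall P : set ((relvar_arity Z).-tuple M), so_sat (dfwith E P) s p
  end.

(* Relation assignments are total; the values chosen here are irrelevant for
   sentences. *)
Definition so_true (sg : signature) (M : structure sg) (phi : so sg) :=
  so_sat (fun=> set0) ([fmap] : assignment M) phi.

(* Expansion by one fresh n-ary relation symbol, namely [None]. *)
Definition expand_sig (sg : signature) (n : nat) : signature :=
  Signature (@fun_arity sg) (oapp (@rel_arity sg) n).

Definition expand (sg : signature) (M : structure sg) (n : nat)
    (P : set (n.-tuple M)) : structure (expand_sig sg n) :=
  @Structure (expand_sig sg n) M (carrier_nonempty M) (@fun_interp sg M)
    (fun R : option (relsym sg) =>
       match R return set ((oapp (@rel_arity sg) n R).-tuple M) with
       | Some R0 => @rel_interp sg M R0
       | None => P
       end).

(* Main.v *)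
(* For the second-order translation, a team is coded by a relation together with
   values for the variables bound so far.  The quantifiers of FOT assign a single
   value to the whole team, so they become first-order quantifiers and leave the
   relation unchanged; only the implication needs a second-order quantifier, which
   ranges over the subrelations.  Correctness holds for every team linked to the
   relation by a bisimulation that compares assignments on the free variables
   only.  A team and its restriction to the free variables are coded by the same
   relation, so locality is a consequence of the translation. *)
Require Import Defs.
From mathcomp Require Import all_boot.
From mathcomp Require Import finmap.
From mathcomp Require Import classical_sets.

Set Implicit Arguments.
Unset Strict Implicit.
Unset Printing Implicit Defensive.

Local Open Scope fset_scope.
Local Open Scope fmap_scope.
Local Open Scope classical_set_scope.

(** * The empty team property *)

Lemma empty_team_sat (sg : signature) (M : structure sg) (phi : fot sg) :
  @sat sg M set0 phi.
Proof.
elim: phi => //=.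
- by left.
- by move=> p IHp q _; left.
(* Substitution keeps the team empty, but the clause still asks for a value, so nonemptiness of the
   domain enters here. *)
- move=> x p IHp; have [a] := carrier_nonempty M.
  by exists a; rewrite /team_subst image_set0.
- by move=> x p IHp a; rewrite /team_subst image_set0.
- by move=> p _ q IHq Y; rewrite subset0 => ->.
Qed.

(** * Lifting a relation from points to sets *)

(** This is the Egli-Milner lifting of [r]: a back-and-forth condition in which neither direction
    has to be functional. *)
Definition linked (A B : Type) (r : A -> B -> Prop) (X : set A) (Y : set B) :=
  (forall s, X s -> exists2 t, Y t & r s t) /\
  (forall t, Y t -> exists2 s, X s & r s t).

Lemma linked_sub (A B : Type) (r r' : A -> B -> Prop) X Y :
  (forall s t, r s t -> r' s t) -> linked r X Y -> linked r' X Y.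
Proof.
by move=> rr' [XY YX]; split=> [s /XY[t]|t /YX[s]]; [exists t|exists s]; auto.
Qed.

Lemma linked_forall (A B : Type) (r : A -> B -> Prop) X Y (P : A -> Prop)
    (Q : B -> Prop) :
  (forall s t, r s t -> (P s <-> Q t)) -> linked r X Y ->
  (forall s, X s -> P s) <-> (forall t, Y t -> Q t).
Proof.
move=> PQ [XY YX]; split=> [XP t /YX[s Xs /PQ PQst]|YQ s /XY[t Yt /PQ PQst]].
  exact/PQst/XP.
exact/PQst/YQ.
Qed.

(** The witness is the [r]-image of [X'] inside [Y]. This and its mirror image below handle the
    quantifier over subteams in the clause for implication. *)
Lemma linked_subl (A B : Type) (r : A -> B -> Prop) X Y X' :
  linked r X Y -> X' `<=` X -> exists2 Y', Y' `<=` Y & linked r X' Y'.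
Proof.
move=> [XY _] X'X; exists [set t | Y t /\ exists2 s, X' s & r s t].
  by move=> t [].
split=> [s X's|t [_ //]].
by have [t Yt rst] := XY _ (X'X _ X's); exists t => //; split=> //; exists s.
Qed.

Lemma linked_subr (A B : Type) (r : A -> B -> Prop) X Y Y' :
  linked r X Y -> Y' `<=` Y -> exists2 X', X' `<=` X & linked r X' Y'.
Proof.
move=> [XY YX] Y'Y; have /linked_subl : linked (fun t s => r s t) Y X by [].
by move=> /(_ _ Y'Y)[X' X'X [Y'X' X'Y']]; exists X'.
Qed.

(** * Tuples of variables and the first-order translation *)

Lemma tuple_valueP (T : Type) (s : assignment T) (n : nat) (x : n.-tuple var) :
  (exists v, tuple_value s x v) <-> (forall i, tnth x i \in domf s).
Proof.
split=> [[v sxv] i|xs]; first by rewrite -fndSome sxv.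
exists [tuple s.[xs i] | i < n] => i.
by rewrite tnth_mktuple in_fnd.
Qed.

(** Definedness is separated from the failure of the coordinatewise equality, so that the second
    part has the shape of a negated conjunction, as in both translations. *)
Lemma tuple_neqP (T : Type) (s : assignment T) (n : nat) (x y : n.-tuple var) :
  (exists v w, [/\ tuple_value s x v, tuple_value s y w & v <> w]) <->
  (forall i, tnth x i \in domf s /\ tnth y i \in domf s) /\
  ~ (forall i, exists2 a, s.[? tnth x i] = Some a & s.[? tnth y i] = Some a).
Proof.
split=> [[v [w [sv sw vw]]]|[def neq]].
  split=> [i|eq]; first by rewrite -!fndSome sv sw.
  apply: vw; apply: eq_from_tnth => i.
  by have [a] := eq i; rewrite sv sw => -[->] [].
have /tuple_valueP[v sv] : forall i, tnth x i \in domf s by move=> i; case: (def i).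
have /tuple_valueP[w sw] : forall i, tnth y i \in domf s by move=> i; case: (def i).
exists v, w; split=> // vw; apply: neq => i; exists (tnth v i) => //.
by rewrite vw.
Qed.

Lemma fo_sat_bigand (sg : signature) (M : structure sg) (s : assignment M)
    (I : eqType) (r : seq I) (F : I -> fo sg) :
  fo_sat s (fo_bigand [seq F i | i <- r]) <->
  (forall i, i \in r -> fo_sat s (F i)).
Proof.
elim: r => [|i [|j r] IHr].
- by split=> // _ /= a; exists a; rewrite fnd_set eqxx.
- split=> /= [Fi j|Fr]; first by rewrite inE => /eqP->.
  by apply: Fr; rewrite inE.
- split=> [/= [Fi /IHr Fr] k|Fr].
    by rewrite inE => /predU1P[->//|]; exact: Fr.
  split; first by apply: Fr; rewrite mem_head.
  by apply/IHr => k kr; apply: Fr; rewrite inE kr orbT.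
Qed.

(** Substitution sends singletons to singletons, and the only subteams of a singleton are itself and
    the empty team. The empty team satisfies everything, so implication becomes classical. *)
Lemma sharpP (sg : signature) (M : structure sg) (phi : fot sg)
    (s : assignment M) :
  (fv phi `<=` domf s)%fset -> fo_sat s (sharp phi) <-> sat [set s] phi.
Proof.
have fv1 x p (t : assignment M) a :
    (fv p `\ x `<=` domf t -> fv p `<=` domf t.[x <- a])%fset.
  by rewrite fsubDset.
elim: phi s => [l|n x y|p IHp|p IHp q IHq|p IHp q IHq|x p IHp|x p IHp
  |p IHp q IHq] s /=; rewrite ?fsubUset => sub.
- by split=> [sl _ ->//|]; apply.
- have -> : (forall t, t = s -> exists v w : n.-tuple M,
      [/\ tuple_value t x v, tuple_value t y w & v <> w]) <->
    exists v w : n.-tuple M,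
      [/\ tuple_value s x v, tuple_value s y w & v <> w].
    by split=> [|? _ ->//]; apply.
  rewrite tuple_neqP fo_sat_bigand.
  have /andP[/fsubsetP subx /fsubsetP suby] := sub.
  split=> [neq|[_ neq] eq].
    split=> [i|eq]; last by apply: neq => i _; exact: eq.
    by split; [apply: subx|apply: suby]; rewrite !inE mem_tnth.
  by apply: neq => i; apply: eq; rewrite mem_enum.
(* A singleton is not empty, which excludes the first alternative of the clause for [FOTneg]. *)
- rewrite IHp //; split=> [np|[/seteqP[/(_ s erefl)]|] //]; by right.
- by move: sub => /andP[subp subq]; rewrite IHp // IHq.
- by move: sub => /andP[subp subq]; rewrite IHp // IHq.
- by split=> -[a pa]; exists a; move: pa;
    rewrite /team_subst image_set1 IHp //; apply: fv1.
- by split=> pa a; move: (pa a);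
    rewrite /team_subst image_set1 IHp //; apply: fv1.
- move: sub => /andP[subp subq]; rewrite IHp // IHq //; split=> [pq Y|]; last exact.
  by move=> /subset_set1[] -> //; move=> _; exact: empty_team_sat.
Qed.

(** * Renaming variables and passing to the expanded signature *)

(* No definedness is required: [s] and [e] may also be both undefined. *)
Definition renaming (T : Type) (V : {fset var}) (f : var -> var)
  (s e : assignment T) := forall z, z \in V -> s.[? z] = e.[? f z].

Lemma renamingS (T : Type) (V W : {fset var}) (f : var -> var)
    (s e : assignment T) : (W `<=` V)%fset -> renaming V f s e -> renaming W f s e.
Proof. by move=> /fsubsetP WV se z /WV/se. Qed.

Fixpoint rename_term (sg : signature) (n : nat) (f : var -> var) (t : term sg)
  : term (expand_sig sg n) :=
  match t with
  | Var x => Var (f x)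
  | App g ts => @App (expand_sig sg n) g (fun i => rename_term n f (ts i))
  end.

Definition rename_atom (sg : signature) (n : nat) (f : var -> var)
    (l : atom sg) : atom (expand_sig sg n) :=
  match l with
  | Eq t u => Eq (rename_term n f t) (rename_term n f u)
  | Rel R ts =>
      @Defs.Rel (expand_sig sg n) (Some R) (fun i => rename_term n f (ts i))
  end.

Lemma renaming_bigcup (T : Type) (k : nat) (V : 'I_k -> {fset var}) f
    (s e : assignment T) i :
  renaming (\bigcup_(i <- enum 'I_k) V i)%fset f s e -> renaming (V i) f s e.
Proof. by apply: renamingS; rewrite bigfcup_sup // mem_enum. Qed.

Lemma rename_termP (sg : signature) (M : structure sg) (n : nat)
    (P : set (n.-tuple M)) (f : var -> var) (s e : assignment M) (t : term sg)
    (a : M) :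
  renaming (term_fv t) f s e ->
  term_value s t a <-> @term_value _ (expand P) e (rename_term n f t) a.
Proof.
elim: t a => [x|g ts IH] a /= se; first by rewrite se ?inE.
by split=> -[v tv <-]; exists v => // i; apply/IH; try exact: tv;
  exact: renaming_bigcup se.
Qed.

Lemma rename_atomP (sg : signature) (M : structure sg) (n : nat)
    (P : set (n.-tuple M)) (f : var -> var) (s e : assignment M) (l : atom sg) :
  renaming (atom_fv l) f s e ->
  atom_sat s l <-> @atom_sat _ (expand P) e (rename_atom n f l).
Proof.
case: l => [t u|R ts] /= se.
  have set_ := renamingS (fsubsetUl _ _) se.
  have seu := renamingS (fsubsetUr _ _) se.
  by split=> -[a ta ua]; exists a;
    do [exact/(rename_termP P _ set_)|exact/(rename_termP P _ seu)].
by split=> -[v tv Rv]; exists v => // i;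
  apply/(rename_termP P _ (renaming_bigcup se)); exact: tv.
Qed.

Lemma term_fv_rename (sg : signature) (n : nat) f (t : term sg) z :
  z \in term_fv (rename_term n f t) -> exists2 y, y \in term_fv t & z = f y.
Proof.
elim: t => [x|g ts IH] /=.
  by rewrite inE => /eqP->; exists x => //; rewrite inE.
move=> /bigfcupP[i _ /IH[y yt ->]]; exists y => //.
by apply/bigfcupP; exists i => //; rewrite mem_enum.
Qed.

Lemma atom_fv_rename (sg : signature) (n : nat) f (l : atom sg) z :
  z \in atom_fv (rename_atom n f l) -> exists2 y, y \in atom_fv l & z = f y.
Proof.
case: l => [t u|R ts] /=.
  rewrite inE => /orP[] /term_fv_rename[y yt ->];
  by exists y => //; rewrite inE yt ?orbT.
move=> /bigfcupP[i _ /term_fv_rename[y yt ->]]; exists y => //.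
by apply/bigfcupP; exists i => //; rewrite mem_enum.
Qed.

(** * Finite conjunctions and blocks of quantifiers *)

Definition so_top (sg : signature) : so sg :=
  SOall 0 (SOatom (Eq (Var 0) (Var 0))).

Lemma so_sat_top (sg : signature) (M : structure sg) E (s : assignment M) :
  so_sat E s (so_top sg).
Proof. by move=> a; exists a; rewrite /= fnd_set eqxx. Qed.

Definition so_bigand (sg : signature) (n : nat) (F : 'I_n -> so sg) : so sg :=
  foldr (fun i p => SOand (F i) p) (so_top sg) (enum 'I_n).

Lemma so_sat_bigand (sg : signature) (M : structure sg) E (s : assignment M)
    (n : nat) (F : 'I_n -> so sg) :
  so_sat E s (so_bigand F) <-> (forall i, so_sat E s (F i)).
Proof.
have -> : so_sat E s (so_bigand F) <->
    (forall i, i \in enum 'I_n -> so_sat E s (F i)).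
  rewrite /so_bigand; elim: (enum _) => [|i r IHr] /=.
    by split=> // _; exact: so_sat_top.
  rewrite IHr; split=> [[Fi Fr] k|Fr].
    by rewrite inE => /predU1P[->//|]; exact: Fr.
  by split=> [|k kr]; apply: Fr; rewrite inE ?eqxx ?kr ?orbT.
by split=> Fi i; [apply: Fi; rewrite mem_enum|].
Qed.

Fixpoint so_alls (sg : signature) (k n : nat) (p : so sg) : so sg :=
  if n is n'.+1 then SOall k (so_alls k.+1 n' p) else p.

Fixpoint assign (T : Type) (s : assignment T) (k : nat) (v : seq T)
  : assignment T :=
  if v is a :: v' then assign s.[k <- a] k.+1 v' else s.

(** The entries of [v] go to distinct variables from [k] on, so none overwrites another; once [v] is
    exhausted, the lookup falls back on [s]. *)
Lemma fnd_assign (T : Type) (s : assignment T) k v z :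
  (assign s k v).[? z] =
    if (k <= z)%N then if onth v (z - k)%N is Some a then Some a else s.[? z]
    else s.[? z].
Proof.
elim: v s k => [|a v IHv] s k /=; first by rewrite onth0n if_same.
rewrite IHv fnd_set; have [//|kz|->] := ltngtP z k; last by rewrite subnn.
by rewrite -(subnSK kz).
Qed.

Lemma fnd_assign0 (T : Type) (s : assignment T) (n : nat) (v : n.-tuple T)
    (i : 'I_n) : (assign s 0 v).[? nat_of_ord i] = Some (tnth v i).
Proof.
rewrite fnd_assign leq0n subn0.
have := onthTE v i; rewrite size_tuple ltn_ord; case vi: onth => [a|//] _.
by rewrite (tnth_nth a) (@onth_nth _ _ _ _ _ vi).
Qed.

Lemma so_sat_alls (sg : signature) (M : structure sg) E (s : assignment M)
    k n p :
  so_sat E s (so_alls k n p) <->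
  (forall v : n.-tuple M, so_sat E (assign s k v) p).
Proof.
elim: n s k => [|n IHn] s k /=.
  by split=> [sp v|/(_ [tuple])//]; rewrite tuple0.
split=> [sp v|sp a].
  by case/tupleP: v => a v; have /IHn := sp a; apply.
by apply/IHn => v; exact: (sp [tuple of a :: v]).
Qed.

Lemma so_fv_alls (sg : signature) k n (p : so sg) z :
  z \in so_fv (so_alls k n p) = (z \in so_fv p) && ~~ (k <= z < k + n)%N.
Proof.
elim: n k => [|n IHn] k /=.
  by rewrite addn0 ltnNge andbN andbT.
rewrite !inE IHn addSnnS; case: (ltngtP z k) => //= ->.
by rewrite addnS ltnS leq_addr andbF.
Qed.

(** * The second-order translation *)

Definition relvar_of (n k : nat) : relvar := (n, k).

(* The relation coding the current team is the expansion symbol for [None], and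
   the relation variable [relvar_of n k] for [Some k]. *)
Definition so_team (sg : signature) (n : nat) (o : option nat)
    : so (expand_sig sg n) :=
  if o is Some k then @SOvar (expand_sig sg n) (relvar_of n k) (fun i => Var i)
  else SOatom (@Defs.Rel (expand_sig sg n) None (fun i => Var i)).

Definition team_of (T : Type) (n : nat) (P : set (n.-tuple T))
    (E : rel_assignment T) (o : option nat) : set (n.-tuple T) :=
  if o is Some k then E (relvar_of n k) else P.

(** An index different from the current one. Hence a subrelation can be quantified while the
    relation that bounds it remains available. *)
Definition next (o : option nat) := if o is Some k then k.+1 else 0.

Definition set_rel (T : Type) (n : nat) (E : rel_assignment T) (k : nat)
    (Q : set (n.-tuple T)) : rel_assignment T :=
  @dfwith _ _ E (relvar_of n k) Q.

Lemma team_of_set_rel (T : Type) (n : nat) (P : set (n.-tuple T))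
    (E : rel_assignment T) (k : nat) (Q : set (n.-tuple T)) :
  team_of P (set_rel E k Q) (Some k) = Q.
Proof. exact: dfwith_in. Qed.

Lemma team_of_next (T : Type) (n : nat) (P : set (n.-tuple T))
    (E : rel_assignment T) (o : option nat) (Q : set (n.-tuple T)) :
  team_of P (set_rel E (next o) Q) o = team_of P E o.
Proof.
case: o => //= k; rewrite /set_rel dfwith_out //.
(* Both relation variables have arity [n], so they differ only in their names. *)
by apply/eqP => -[/eqP]; rewrite -[_ == _]/(k.+1 == k) gtn_eqF.
Qed.

Lemma so_sat_team (sg : signature) (M : structure sg) (n : nat)
    (P : set (n.-tuple M)) E (p : assignment M) (o : option nat)
    (v : n.-tuple M) :
  @so_sat _ (expand P) E (assign p 0 v) (so_team sg n o) <-> team_of P E o v.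
Proof.
(* Evaluation is relational and yields some tuple [w]; the values of the first [n] variables force
   it to be [v]. *)
have vE (w : n.-tuple M) :
    (forall i : 'I_n, (assign p 0 v).[? nat_of_ord i] = Some (tnth w i)) ->
    v = w.
  by move=> vw; apply: eq_from_tnth => i; move: (vw i); rewrite fnd_assign0 => -[].
by case: o => [k|] /=; (split=> [[w /vE-> //]|Pv]; exists v => // i);
  exact: fnd_assign0.
Qed.

(** A universal quantifier relativised to the coded team. It renders the flat conditions, which
    speak of each assignment of the team separately. *)
Definition guarded (sg : signature) (n : nat) (o : option nat)
    (p : so (expand_sig sg n)) : so (expand_sig sg n) :=
  so_alls 0 n (SOimp (so_team sg n o) p).

Lemma so_sat_guarded (sg : signature) (M : structure sg) (n : nat)
    (P : set (n.-tuple M)) E (s : assignment M) (o : option nat) p :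
  @so_sat _ (expand P) E s (guarded o p) <->
  (forall v, team_of P E o v -> @so_sat _ (expand P) E (assign s 0 v) p).
Proof.
by rewrite so_sat_alls; split=> pv v; have := pv v; rewrite /= so_sat_team.
Qed.

(* The equations [z = z] express that the variables are defined. *)
Definition so_neq (sg : signature) (n : nat) (x y : n.-tuple var) : so sg :=
  let eq a b := SOatom (Eq (Var a) (Var b)) in
  SOand (so_bigand (fun i => SOand (eq (tnth x i) (tnth x i))
                                   (eq (tnth y i) (tnth y i))))
        (SOneg (so_bigand (fun i => eq (tnth x i) (tnth y i)))).

Lemma so_neqP (sg : signature) (M : structure sg) E (s : assignment M) n
    (x y : n.-tuple var) :
  so_sat E s (so_neq sg x y) <->
  (exists v w, [/\ tuple_value s x v, tuple_value s y w & v <> w]).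
Proof.
have def z : (exists2 a, s.[? z] = Some a & s.[? z] = Some a) <-> z \in domf s.
  rewrite -fndSome; case: fnd => [a|]; split=> //; first by exists a.
  by case.
rewrite tuple_neqP /= !so_sat_bigand.
suff -> : (forall i, so_sat E s (SOand (SOatom (Eq (Var (tnth x i)) (Var (tnth x i))))
  (SOatom (Eq (Var (tnth y i)) (Var (tnth y i)))))) <->
  (forall i, tnth x i \in domf s /\ tnth y i \in domf s) by [].
by split=> xy i; have [/def ? /def ?] := xy i.
Qed.

(* A team is coded by an [n]-ary relation over the variables [0, ..., n - 1],
   together with an assignment of the variables [n, ..., m - 1], which hold the
   values of the variables bound by the quantifiers; [f] maps the variables of
   the formula to those. *)
Fixpoint so_of (sg : signature) (n : nat) (o : option nat) (m : nat)
    (f : var -> var) (phi : fot sg) : so (expand_sig sg n) :=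
  match phi with
  | FOTatom l => guarded o (SOatom (rename_atom n f l))
  | FOTneq _ x y => guarded o (so_neq _ (map_tuple f x) (map_tuple f y))
  | FOTneg p => SOor (guarded o (SOneg (so_top _))) (SOneg (so_of n o m f p))
  | FOTand p q => SOand (so_of n o m f p) (so_of n o m f q)
  | FOTor p q => SOor (so_of n o m f p) (so_of n o m f q)
  | FOTex1 x p => SOex m (so_of n o m.+1 [eta f with x |-> m] p)
  | FOTall1 x p => SOall m (so_of n o m.+1 [eta f with x |-> m] p)
  | FOTimp p q =>
      SOallR (relvar_of n (next o))
        (SOimp (guarded (Some (next o)) (so_team sg n o))
               (SOimp (so_of n (Some (next o)) m f p)
                      (so_of n (Some (next o)) m f q)))
  end.

(** * Correctness of the translation *)

(** The bisimulation relation. Neither side determines the other: assignments may differ outside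
    [V], and a column of the relation is no longer read once its variable has been rebound. *)
Definition codes (T : Type) (n : nat) (V : {fset var}) (f : var -> var)
    (p : assignment T) (s : assignment T) (v : n.-tuple T) :=
  renaming V f s (assign p 0 v).

(** The whole team receives one value, so partners remain partners and [P] stays unchanged. The
    variable [m] is fresh: it lies beyond the [n] columns and is not the image of a variable of [V]
    other than [x]. *)
Lemma linked_subst (T : Type) (n m : nat) (V : {fset var}) (f : var -> var)
    (p : assignment T) (X : set (assignment T)) (P : set (n.-tuple T)) x a :
  n <= m -> (forall z, z \in (V `\ x)%fset -> f z < m) ->
  linked (codes (V `\ x)%fset f p) X P ->
  linked (codes V [eta f with x |-> m] p.[m <- a]) (team_subst X a x) P.
Proof.
move=> nm fm [XP PX].
have codesV s (v : n.-tuple T) : codes (V `\ x)%fset f p s v ->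
    codes V [eta f with x |-> m] p.[m <- a] s.[x <- a] v.
  move=> sv z zV; rewrite fnd_set /= fnd_assign leq0n subn0 fnd_set.
  (* At [x] the lookup is at [m], past the end of [v] because [n <= m], and therefore finds [a]. *)
  have [zx|zx] := eqVneq z x; first by rewrite onth_default ?size_tuple ?eqxx.
  have zVx : z \in (V `\ x)%fset by rewrite !inE zx.
  by rewrite (sv _ zVx) fnd_assign leq0n subn0 (ltn_eqF (fm _ zVx)).
split=> [_ [s Xs <-]|v /PX[s Xs sv]].
  by have [v Pv sv] := XP _ Xs; exists v => //; exact: codesV.
by exists s.[x <- a]; [exists s|exact: codesV].
Qed.

Lemma linked_codesU (T : Type) (n : nat) (V W : {fset var}) (f : var -> var)
    (p : assignment T) (X : set (assignment T)) (P : set (n.-tuple T)) :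
  linked (codes (V `|` W)%fset f p) X P ->
  linked (codes V f p) X P /\ linked (codes W f p) X P.
Proof.
by move=> XP; split; apply: linked_sub XP => s v; apply: renamingS;
  rewrite ?fsubsetUl ?fsubsetUr.
Qed.

Lemma bound_fsetU (V W : {fset var}) (f : var -> var) m :
  (forall z, z \in (V `|` W)%fset -> f z < m) ->
  (forall z, z \in V -> f z < m) /\ (forall z, z \in W -> f z < m).
Proof.
by move=> fm; split=> z zVW; apply: fm; rewrite inE zVW ?orbT.
Qed.

Lemma bound_subst (V : {fset var}) x (f : var -> var) m :
  (forall z, z \in (V `\ x)%fset -> f z < m) ->
  forall z, z \in V -> [eta f with x |-> m] z < m.+1.
Proof.
move=> fm z zV /=; case: eqVneq => // zx.
by apply/ltnW; rewrite ltnS fm // !inE zx.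
Qed.

Lemma so_neq_renaming (sg : signature) (M : structure sg) E n (f : var -> var)
    (x y : n.-tuple var) (s e : assignment M) :
  renaming ([fset z in tval x] `|` [fset z in tval y])%fset f s e ->
  (exists v w, [/\ tuple_value s x v, tuple_value s y w & v <> w]) <->
  so_sat E e (so_neq sg (map_tuple f x) (map_tuple f y)).
Proof.
move=> se; rewrite so_neqP.
have sx v : tuple_value s x v <-> tuple_value e (map_tuple f x) v.
  by split=> sv i; have := sv i; rewrite tnth_map se // !inE mem_tnth.
have sy v : tuple_value s y v <-> tuple_value e (map_tuple f y) v.
  by split=> sv i; have := sv i; rewrite tnth_map se // !inE mem_tnth orbT.
by split=> -[v [w [/sx ? /sy ? ?]]]; exists v, w.
Qed.

(** The claim is made for all linked pairs, a property stable under substitution and under passage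
    to subteams. Flat clauses follow from [linked_forall], quantifiers from [linked_subst], and
    implication from the matching of subteams with subrelations. *)
Lemma so_ofP (sg : signature) (M : structure sg) (n : nat)
    (P : set (n.-tuple M)) (phi : fot sg) (o : option nat) (m : nat)
    (f : var -> var) (E : rel_assignment M) (p : assignment M)
    (X : set (assignment M)) :
  n <= m -> (forall z, z \in fv phi -> f z < m) ->
  linked (codes (fv phi) f p) X (team_of P E o) ->
  sat X phi <-> @so_sat _ (expand P) E p (so_of n o m f phi).
Proof.
elim: phi o m f E p X => [l|k x y|q IHq|q IHq r IHr|q IHq r IHr|x q IHq|x q IHq
  |q IHq r IHr] o m f E p X nm fm XP.
- rewrite so_sat_guarded; apply: linked_forall XP => s v; exact: rename_atomP.
- rewrite so_sat_guarded; apply: linked_forall XP => s v.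
  exact: (@so_neq_renaming _ (expand P)).
- rewrite /= so_sat_guarded -(IHq _ _ _ _ _ _ nm fm XP).
  (* Emptiness becomes the flat condition that every assignment satisfies falsity, which a link
     preserves. *)
  have -> : X = set0 <-> (forall s, X s -> False).
    by split=> [->//|X0]; apply/seteqP; split=> // s /X0.
  rewrite (linked_forall _ XP (Q := fun=> False)) //.
  by split=> -[X0|]; [left=> v /X0|right|left=> v /X0 []; exact: so_sat_top|right].
- have [fq fr] := bound_fsetU fm; have [XPq XPr] := linked_codesU XP.
  by rewrite /= -(IHq _ _ _ _ _ _ nm fq XPq) -(IHr _ _ _ _ _ _ nm fr XPr).
- have [fq fr] := bound_fsetU fm; have [XPq XPr] := linked_codesU XP.
  by rewrite /= -(IHq _ _ _ _ _ _ nm fq XPq) -(IHr _ _ _ _ _ _ nm fr XPr).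
- have IH a := IHq _ _ _ _ _ _ (leqW nm) (bound_subst fm)
    (linked_subst a nm fm XP).
  by split=> -[a qa]; exists a; apply/IH.
- have IH a := IHq _ _ _ _ _ _ (leqW nm) (bound_subst fm)
    (linked_subst a nm fm XP).
  by split=> qa a; apply/IH.
- have [fq fr] := bound_fsetU fm.
  have IH (Y : set (assignment M)) (Q : set (n.-tuple M)) :
      linked (codes (fv (FOTimp q r)) f p) Y Q ->
      (sat Y q -> sat Y r) <->
      so_sat (M := expand P) (set_rel E (next o) Q) p
        (SOimp (so_of n (Some (next o)) m f q)
               (so_of n (Some (next o)) m f r)).
    (* [Q] is reread as the value of the new relation variable, the form in which the induction
       hypotheses apply. *)
    rewrite -{1}(team_of_set_rel P E (next o) Q) => YQ; have [YQq YQr] := linked_codesU YQ.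
    have IHqY := IHq _ _ _ _ _ _ nm fq YQq.
    have IHrY := IHr _ _ _ _ _ _ nm fr YQr.
    by split=> qr /IHqY qY; apply/IHrY/qr.
  (* The guard expresses inclusion in the current relation, whose value survives the assignment to
     the new relation variable. *)
  have sub Q : so_sat (M := expand P) (set_rel E (next o) Q) p
      (guarded (Some (next o)) (so_team sg n o)) <-> Q `<=` team_of P E o.
    rewrite so_sat_guarded team_of_set_rel.
    by split=> QP v /QP; rewrite so_sat_team team_of_next.
  rewrite [so_of _ _ _ _ _]/=; split=> [XY Q /sub QP|XY Y YX].
    by have [Y YX /IH YQ] := linked_subr XP QP; apply/YQ; exact: XY.
  have [Q QP /IH YQ] := linked_subl XP YX.
  by apply/YQ; apply: (XY Q); apply/sub.
Qed.

(** * Free variables of the translation *)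

Lemma so_team_fv (sg : signature) (n : nat) o z :
  z \in so_fv (so_team sg n o) -> z < n.
Proof.
by case: o => [k|] /= /bigfcupP[i _]; rewrite inE => /eqP->.
Qed.

Lemma guarded_fv (sg : signature) (n : nat) o p z :
  z \in so_fv (@guarded sg n o p) -> z \in so_fv p /\ n <= z.
Proof.
rewrite so_fv_alls /= inE -leqNgt => /andP[/orP[/so_team_fv zn|-> ->//]].
by rewrite leqNgt zn.
Qed.

Lemma so_bigand_fv (sg : signature) (n : nat) (F : 'I_n -> so sg) z :
  z \in so_fv (so_bigand F) -> exists i, z \in so_fv (F i).
Proof.
rewrite /so_bigand; elim: (enum _) => [|i r IHr] /=.
  by rewrite !inE orbb; case: eqP.
by rewrite inE => /orP[|//]; exists i.
Qed.

Lemma so_neq_fv (sg : signature) (n : nat) (x y : n.-tuple var) z :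
  z \in so_fv (so_neq sg x y) -> z \in x \/ z \in y.
Proof.
rewrite /= inE => /orP[] /so_bigand_fv[i]; rewrite /= !inE ?orbb => /orP[] /eqP->.
- by left; rewrite mem_tnth.
- by right; rewrite mem_tnth.
- by left; rewrite mem_tnth.
- by right; rewrite mem_tnth.
Qed.

(** The guards bind the columns, and each quantifier binds the variable [m] that it introduces. For
    [m = n] the interval is empty, so the translation is closed. *)
Lemma so_of_fv (sg : signature) (n : nat) (phi : fot sg) o m f z :
  n <= m -> (forall z, z \in fv phi -> f z < m) ->
  z \in so_fv (so_of n o m f phi) -> n <= z < m.
Proof.
elim: phi o m f => [l|k x y|q IHq|q IHq r IHr|q IHq r IHr|x q IHq|x q IHq
  |q IHq r IHr] o m f nm fm.
- by move=> /guarded_fv[/atom_fv_rename[y /fm ym ->] ->].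
- move=> /guarded_fv[/so_neq_fv[] /mapP[y' xy ->] ->]; apply: fm.
    by rewrite !inE xy.
  by rewrite !inE xy orbT.
- rewrite /= inE => /orP[/guarded_fv[]|]; last exact: IHq.
  by rewrite /= !inE orbb; case: eqP.
- have [fq fr] := bound_fsetU fm.
  by rewrite /= inE => /orP[]; [exact: IHq|exact: IHr].
- have [fq fr] := bound_fsetU fm.
  by rewrite /= inE => /orP[]; [exact: IHq|exact: IHr].
- rewrite /= !inE => /andP[zm /(IHq _ _ _ (leqW nm) (bound_subst fm))].
  by rewrite ltnS => /andP[-> ?]; rewrite ltn_neqAle zm.
- rewrite /= !inE => /andP[zm /(IHq _ _ _ (leqW nm) (bound_subst fm))].
  by rewrite ltnS => /andP[-> ?]; rewrite ltn_neqAle zm.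
- have [fq fr] := bound_fsetU fm.
  rewrite /= !inE => /or3P[/guarded_fv[/so_team_fv zn]||].
  + by rewrite leqNgt zn.
  + exact: IHq.
  + exact: IHr.
Qed.

Definition team_frv (n : nat) (o : option nat) : {fset relvar} :=
  (if o is Some k then [fset relvar_of n k] else fset0)%fset.

Lemma guarded_frv (sg : signature) (n : nat) o (p : so (expand_sig sg n)) :
  so_frv (guarded o p) = (team_frv n o `|` so_frv p)%fset.
Proof.
have alls k j (q : so (expand_sig sg n)) : so_frv (so_alls k j q) = so_frv q.
  by elim: j k => //=.
by rewrite alls; case: o.
Qed.

Lemma so_bigand_frv (sg : signature) (n : nat) (F : 'I_n -> so sg) :
  (forall i, so_frv (F i) = fset0) -> so_frv (so_bigand F) = fset0.
Proof.
move=> F0; rewrite /so_bigand; elim: (enum _) => //= i r ->.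
by rewrite F0 fsetU0.
Qed.

Lemma so_neq_frv (sg : signature) (n : nat) (x y : n.-tuple var) :
  so_frv (so_neq sg x y) = fset0.
Proof. by rewrite /= !so_bigand_frv ?fsetU0 // => i; rewrite /= fsetU0. Qed.

(** Each implication binds the relation variable that it introduces, which leaves at most the one
    naming the current team; for [None] there is none. *)
Lemma so_of_frv (sg : signature) (n : nat) (phi : fot sg) o m f :
  (so_frv (so_of n o m f phi) `<=` team_frv n o)%fset.
Proof.
elim: phi o m f => [l|k x y|q IHq|q IHq r IHr|q IHq r IHr|x q IHq|x q IHq
  |q IHq r IHr] o m f //.
- by rewrite guarded_frv fsetU0.
- by rewrite guarded_frv so_neq_frv fsetU0.
- by rewrite /= guarded_frv fsetU0 fsubUset fsubset_refl IHq.
- by rewrite fsubUset IHq IHr.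
- by rewrite fsubUset IHq IHr.
- exact: IHq.
- exact: IHq.
- have subU V : (V `<=` team_frv n (Some (next o)))%fset ->
      (V `<=` relvar_of n (next o) |` team_frv n o)%fset.
    by move=> /fsubset_trans; apply; exact: fsubsetUl.
  rewrite /= guarded_frv fsubDset !fsubUset fsubsetUl (subU _ (IHq _ _ _)).
  rewrite (subU _ (IHr _ _ _)) !andbT.
  by case: o {subU} => [k|]; [exact: fsubsetUr|exact: fsub0set].
Qed.

(** * The defining sentence and locality *)

(** At the start no variable is bound, so [m = n], the team is coded by the fresh symbol, and each
    free variable is sent to its position in [x]. *)
Definition phistar (sg : signature) (n : nat) (x : n.-tuple var)
    (phi : fot sg) : so (expand_sig sg n) :=
  so_of n None n (index^~ x) phi.

Lemma phistar_sentence (sg : signature) (n : nat) (x : n.-tuple var)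
    (phi : fot sg) : x =i fv phi -> so_sentence (phistar x phi).
Proof.
move=> xfv; split; apply/fsetP => z; rewrite in_fset0; apply/negbTE/negP.
  move=> zfv; suff /andP[nz] : n <= z < n by rewrite ltnNge nz.
  by apply: so_of_fv zfv => // y; rewrite -xfv -index_mem size_tuple.
by move=> /(fsubsetP (so_of_frv _ _ _ _ _)).
Qed.

Lemma phistarP (sg : signature) (M : structure sg) (n : nat)
    (x : n.-tuple var) (phi : fot sg) (X : set (assignment M)) :
  uniq x -> x =i fv phi -> (forall s, X s -> (fv phi `<=` domf s)%fset) ->
  sat X phi <-> so_true (expand (team_rel x X)) (phistar x phi).
Proof.
move=> ux xfv dom; apply: so_ofP => // [z|].
  by rewrite -xfv -index_mem size_tuple.
have code s v : tuple_value s x v -> codes (fv phi) (index^~ x) [fmap] s v.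
  move=> sv z; rewrite -xfv => zx.
  have zn : index z x < n by rewrite -{2}(size_tuple x) index_mem.
  have := sv (Ordinal zn); rewrite (tnth_nth z) nth_index // => ->.
  by rewrite -[index z x]/(val (Ordinal zn)) fnd_assign0.
split=> [s Xs|v [s Xs sv]]; last by exists s => //; exact: code.
have /tuple_valueP[v sv] : forall i, tnth x i \in domf s.
  by move=> i; apply: (fsubsetP (dom _ Xs)); rewrite -xfv mem_tnth.
by exists v; [exists s|exact: code].
Qed.

Lemma sat_restrict (sg : signature) (M : structure sg) (X : set (assignment M))
    (phi : fot sg) :
  (forall s, X s -> (fv phi `<=` domf s)%fset) ->
  sat X phi <-> sat (team_restrict X (fv phi)) phi.
Proof.
move=> dom.
pose x := in_tuple (enum_fset (fv phi)).
have ux : uniq x by exact: fset_uniq.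
have xfv : x =i fv phi by [].
rewrite (phistarP ux xfv dom) (phistarP ux xfv).
  (* Both sides have become the same sentence, so it remains to see that the two expansions
     coincide. *)
  suff -> : team_rel x (team_restrict X (fv phi)) = team_rel x X by [].
  have value_restrict (s : assignment M) v :
      tuple_value s.[& fv phi] x v <-> tuple_value s x v.
    by split=> sv i; have := sv i; rewrite fnd_restrict -xfv mem_tnth.
  apply/seteqP; split=> [v [_ [s Xs <-] /value_restrict]|v [s Xs sv]].
    by exists s.
  by exists s.[& fv phi]; [exists s|apply/value_restrict].
move=> _ [s Xs <-]; rewrite domf_restrict.
by rewrite fsubsetI fsubset_refl dom.
Qed.

Theorem proposition4p2 (sg : signature) :
  (forall (M : structure sg) (phi : fot sg),
     @sat sg M set0 phi)
  /\
  (forall (M : structure sg) (D : {fset var}) (X : set (assignment M))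
          (phi : fot sg),
     is_team D X -> (fv phi `<=` D)%fset ->
     (sat X phi <-> sat (team_restrict X (fv phi)) phi))
  /\
  (forall (M : structure sg) (phi : fot sg) (s : assignment M),
     (fv phi `<=` domf s)%fset ->
     (fo_sat s (sharp phi) <-> sat [set s]%classic phi))
  /\
  (forall (sigma : fot sg) (M : structure sg),
     fot_sentence sigma ->
     (fo_true M (sharp sigma) <-> fot_true M sigma))
  /\
  (forall (phi : fot sg) (n : nat) (x : n.-tuple var),
     uniq x -> x =i fv phi ->
     exists phistar : so (expand_sig sg n),
       so_sentence phistar /\
       forall (M : structure sg) (X : set (assignment M)),
         is_team (fv phi) X ->
         (sat X phi <-> so_true (expand (team_rel x X)) phistar)).
Proof.
split; first exact: empty_team_sat.
split.
  move=> M D X phi XD phiD; apply: sat_restrict => s Xs.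
  by rewrite (XD _ Xs).
split; first by move=> M phi s; exact: sharpP.
split.
  move=> sigma M sigma0; apply: sharpP; rewrite sigma0; exact: fsub0set.
move=> phi n x ux xfv; exists (phistar x phi); split.
  exact: phistar_sentence.
by move=> M X XD; apply: phistarP => // s Xs; rewrite (XD _ Xs).
Qed.
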